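(* Let $R$ be a commutative unital ring, let $A$ and $B$ be unital associative $R$-algebras and let $M$ be a nonzero $(A,B)$-bimodule that is faithful as a left $A$-module and as a right $B$-module. Let $\mathcal{T}=\mathrm{Trian}(A,M,B)$ be the associated triangular algebra and $\sigma$ an automorphism of $\mathcal{T}$. Assume that $A$ and $B$ have only trivial idempotents. If a $\sigma$-derivation $d$ of $\mathcal{T}$ is $\sigma$-centralizing, then $d=0$.
   Context: The triangular algebra $\mathrm{Trian}(A,M,B)$ is the set of all matrices $\begin{pmatrix} a & m\\ & b\end{pmatrix}$ with $a\in A$, $m\in M$, $b\in B$, which is a unital associative $R$-algebra under the usual matrix operations. Automorphisms are $R$-algebra automorphisms. An algebra has only trivial idempotents if $0$ and $1$ are its only idempotents. For an automorphism $\sigma$ of an algebra $\mathcal{A}$, a $\sigma$-derivation of $\mathcal{A}$ is an $R$-linear map $d:\mathcal{A}\to\mathcal{A}$ with $d(xy)=d(x)y+\sigma(x)d(y)$ for all $x,y\in\mathcal{A}$; an $R$-linear map $\Theta:\mathcal{A}\to\mathcal{A}$ is $\sigma$-centralizing if $\sigma(x)\Theta(x)-\Theta(x)x\in \mathrm{Z}(\mathcal{A})$ for all $x\in\mathcal{A}$, where $\mathrm{Z}(\mathcal{A})$ is the center of $\mathcal{A}$. *)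

(* Defs.v *)
From HB Require Import structures.
From mathcomp Require Import all_boot all_order all_algebra.
Set Implicit Arguments.
Unset Strict Implicit.
Unset Printing Implicit Defensive.
Import GRing.Theory.
Local Open Scope ring_scope.

(* (A, B)-bimodules over R-algebras A and B: [ract_alg] says that the two     *)
(* R-module structures that M inherits from A and from B coincide, as is      *)
(* needed for Trian A M B to be an R-algebra.                                 *)
HB.mixin Record Lmodule_isBimodule (R : comPzRingType) (A B : algType R) M
    of GRing.Lmodule A M := {
  ract : M -> B -> M;
  ractA : forall m b c, ract (ract m b) c = ract m (b * c);
  ract1 : forall m, ract m 1 = m;
  ractDl : forall m n b, ract (m + n) b = ract m b + ract n b;
  ractDr : forall m b c, ract m (b + c) = ract m b + ract m c;
  lractA : forall (a : A) m b, ract (a *: m) b = a *: ract m b;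
  ract_alg : forall (r : R) m, ract m r%:A = (r%:A : A) *: m
}.

#[short(type="bimodType")]
HB.structure Definition Bimodule (R : comPzRingType) (A B : algType R) :=
  {M of GRing.Lmodule A M & Lmodule_isBimodule R A B M}.

Notation "m :* b" := (ract m b) : ring_scope.

Section BimoduleTheory.
Variables (R : comPzRingType) (A B : algType R) (M : bimodType A B).

Definition left_faithful := forall a : A, (forall m : M, a *: m = 0) -> a = 0.

Definition right_faithful := forall b : B, (forall m : M, m :* b = 0) -> b = 0.

End BimoduleTheory.

Arguments left_faithful {R A B} M.
Arguments right_faithful {R A B} M.

(* [TrianMx a m b] is the matrix with rows (a, m) and (0, b). *)
Record trian (R : comPzRingType) (A B : algType R) (M : bimodType A B) :=
  TrianMx { trian_ul : A; trian_ur : M; trian_dr : B }.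

Notation Trian A M B := (@trian _ A B M).

Section TriangularAlgebra.
Variables (R : comPzRingType) (A B : algType R) (M : bimodType A B).
Local Notation T := (Trian A M B).
Implicit Types x y z : T.

Let to_prod x : A * M * B := (trian_ul x, trian_ur x, trian_dr x).
Let of_prod (p : A * M * B) : T := TrianMx p.1.1 p.1.2 p.2.
Let to_prodK : cancel to_prod of_prod. Proof. by case. Qed.

HB.instance Definition _ := Choice.copy T (can_type to_prodK).

Definition trian_zero : T := TrianMx 0 0 0.

Definition trian_opp x : T :=
  TrianMx (- trian_ul x) (- trian_ur x) (- trian_dr x).

Definition trian_add x y : T :=
  TrianMx (trian_ul x + trian_ul y) (trian_ur x + trian_ur y)
          (trian_dr x + trian_dr y).

Definition trian_one : T := TrianMx 1 0 1.

Definition trian_mul x y : T :=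
  TrianMx (trian_ul x * trian_ul y)
          (trian_ul x *: trian_ur y + trian_ur x :* trian_dr y)
          (trian_dr x * trian_dr y).

Definition trian_scale (r : R) x : T :=
  TrianMx (r *: trian_ul x) ((r%:A : A) *: trian_ur x) (r *: trian_dr x).

Let trian_addA : associative trian_add.
Proof. by move=> x y z; congr TrianMx; apply: addrA. Qed.

Let trian_addC : commutative trian_add.
Proof. by move=> x y; congr TrianMx; apply: addrC. Qed.

Let trian_add0 : left_id trian_zero trian_add.
Proof. by case=> a m b; congr TrianMx; apply: add0r. Qed.

Let trian_addN : left_inverse trian_zero trian_opp trian_add.
Proof. by move=> x; congr TrianMx; apply: addNr. Qed.

HB.instance Definition _ :=
  GRing.isZmodule.Build T trian_addA trian_addC trian_add0 trian_addN.

Let ract0l (b : B) : (0 : M) :* b = 0.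
Proof. by apply: (addrI ((0 : M) :* b)); rewrite -ractDl !addr0. Qed.

Let trian_mulA : associative trian_mul.
Proof.
move=> x y z; congr TrianMx; rewrite ?mulrA //=.
by rewrite scalerDr ractDl scalerA ractA lractA addrA.
Qed.

Let trian_mul1l : left_id trian_one trian_mul.
Proof.
by case=> a m b; congr TrianMx; rewrite /= ?mul1r // scale1r ract0l addr0.
Qed.

Let trian_mul1r : right_id trian_one trian_mul.
Proof.
by case=> a m b; congr TrianMx; rewrite /= ?mulr1 // scaler0 ract1 add0r.
Qed.

Let trian_mulDl : left_distributive trian_mul +%R.
Proof.
move=> x y z; congr TrianMx; rewrite ?mulrDl //=.
by rewrite scalerDl ractDl addrACA.
Qed.

Let trian_mulDr : right_distributive trian_mul +%R.
Proof.
move=> x y z; congr TrianMx; rewrite ?mulrDr //=.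
by rewrite scalerDr ractDr addrACA.
Qed.

Let trian_one_neq0 : trian_one != 0.
Proof.
by apply/eqP => /(congr1 (@trian_ul _ _ _ _)) /eqP; rewrite /= oner_eq0.
Qed.

HB.instance Definition _ :=
  GRing.Zmodule_isNzRing.Build T trian_mulA trian_mul1l trian_mul1r
    trian_mulDl trian_mulDr trian_one_neq0.

Let trian_scaleA r s x : trian_scale r (trian_scale s x) = trian_scale (r * s) x.
Proof.
congr TrianMx; rewrite /= ?scalerA //.
by rewrite -scalerAl mul1r scalerA.
Qed.

Let trian_scale1 : left_id 1 trian_scale.
Proof. by case=> a m b; congr TrianMx; rewrite /= ?scale1r. Qed.

Let trian_scaleDr : right_distributive trian_scale +%R.
Proof. by move=> r x y; congr TrianMx; apply: scalerDr. Qed.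

Let trian_scaleDl x : {morph trian_scale^~ x : r s / r + s}.
Proof. by move=> r s; congr TrianMx; rewrite /= !scalerDl. Qed.

HB.instance Definition _ :=
  GRing.Zmodule_isLmodule.Build R T trian_scaleA trian_scale1
    trian_scaleDr trian_scaleDl.

Let trian_scaleAl (r : R) (x y : T) : r *: (x * y) = (r *: x) * y.
Proof.
congr TrianMx; rewrite /= ?scalerAl //.
by rewrite scalerDr lractA scalerA -scalerAl mul1r.
Qed.

HB.instance Definition _ := GRing.Lmodule_isLalgebra.Build R T trian_scaleAl.

Let trian_scaleAr (r : R) (x y : T) : r *: (x * y) = x * (r *: y).
Proof.
congr TrianMx; rewrite /= ?scalerAr //.
rewrite scalerDr !scalerA -scalerAl mul1r -scalerAr mulr1 -ract_alg ractA.
by rewrite -scalerAr mulr1.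
Qed.

HB.instance Definition _ := GRing.Lalgebra_isAlgebra.Build R T trian_scaleAr.

End TriangularAlgebra.

Section SigmaMaps.
Variables (R : comPzRingType) (S : algType R).

Definition only_trivial_idempotents :=
  forall e : S, e * e = e -> e = 0 \/ e = 1.

Definition central (z : S) := forall y : S, z * y = y * z.

Definition is_automorphism (sigma : {lrmorphism S -> S}) := bijective sigma.

Definition is_sigma_derivation (sigma : {lrmorphism S -> S})
    (d : {linear S -> S}) :=
  forall x y : S, d (x * y) = d x * y + sigma x * d y.

Definition is_sigma_centralizing (sigma : {lrmorphism S -> S})
    (Theta : {linear S -> S}) :=
  forall x : S, central (sigma x * Theta x - Theta x * x).

End SigmaMaps.

Arguments only_trivial_idempotents {R} S.

(* Main.v *)
Require Import Defs.
From HB Require Import structures.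
From mathcomp Require Import all_boot all_order all_algebra.
Import GRing.Theory.
Local Open Scope ring_scope.

(** Let e and f be the diagonal matrix units of T. Since A and B have only
    trivial idempotents, sigma e has diagonal (1, 0): the diagonal (0, 1) would
    make sigma f * T * sigma e nonzero, although f * T * e = 0. The derivation
    rule for e * e = e then forces d e to be strictly upper triangular, so
    sigma e * d e - d e * e = d e, which is central only if d e = 0. Linearizing
    the centralizing condition at e kills d on M in the same way. Finally
    d (a * m) = 0 and d (m * b) = 0 give d a * m = 0 and sigma m * d b = 0, and
    faithfulness of M yields d = 0 on the two diagonal corners. *)

Section Trian.
Variables (R : comPzRingType) (A B : algType R) (M : bimodType A B).
Local Notation T := (Trian A M B).
Implicit Types (a : A) (b : B) (m : M) (t : T).

Lemma ract0l b : (0 : M) :* b = 0.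
Proof. by apply: (addrI ((0 : M) :* b)); rewrite -ractDl !addr0. Qed.

Lemma ract0r m : m :* (0 : B) = 0.
Proof. by apply: (addrI (m :* (0 : B))); rewrite -ractDr !addr0. Qed.

Lemma trianM a m b a' m' b' :
  TrianMx a m b * TrianMx a' m' b' =
    TrianMx (a * a') (a *: m' + m :* b') (b * b') :> T.
Proof. by []. Qed.

Lemma trianD a m b a' m' b' :
  TrianMx a m b + TrianMx a' m' b' = TrianMx (a + a') (m + m') (b + b') :> T.
Proof. by []. Qed.

Lemma trianB a m b a' m' b' :
  TrianMx a m b - TrianMx a' m' b' = TrianMx (a - a') (m - m') (b - b') :> T.
Proof. by []. Qed.

Definition trian_e : T := TrianMx 1 0 0.
Definition trian_f : T := TrianMx 0 0 1.
Local Notation e := trian_e.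
Local Notation f := trian_f.

Lemma trian_eE : e = TrianMx 1 0 0. Proof. by []. Qed.
Lemma trian_fE : f = TrianMx 0 0 1. Proof. by []. Qed.

Definition trianE := (trian_eE, trian_fE, trianM, trianB, trianD).

Definition bimodE := (mul0r, mulr0, mul1r, mulr1, scale0r, scale1r, scaler0,
  ract0l, ract0r, (@ract1 R A B M), addr0, add0r, subr0, sub0r, oppr0).

Lemma trian_f_sub : f = 1 - e.
Proof. by rewrite trianE (trianB 1 0 1) subrr !subr0. Qed.

Lemma trian_ee : e * e = e.
Proof. by rewrite ?trianE /= ?bimodE. Qed.

(** Left multiplication by [e] keeps the upper right entry, right multiplication by [e] kills it. *)
Lemma central_ur m : central (TrianMx 0 m 0 : T) -> m = 0.
Proof. by move=> /(_ e); rewrite ?trianE /= ?bimodE => -[]. Qed.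

(** Strictly upper triangular matrices square to zero. *)
Lemma idempotent_ur0 m :
  TrianMx 0 m 0 * TrianMx 0 m 0 = TrianMx 0 m 0 :> T -> m = 0.
Proof. by rewrite ?trianE /= ?bimodE => -[]. Qed.

Section Automorphism.
Variable sigma : {lrmorphism T -> T}.
Hypothesis sigma_aut : is_automorphism sigma.

Lemma rmorph_trian_f : sigma f = 1 - sigma e.
Proof. by rewrite trian_f_sub rmorphB rmorph1. Qed.

(** Every [t] is [sigma (tau t)] by surjectivity, so the product is [sigma (x * tau t * y)]. *)
Lemma automorphism_mul0 x y :
  (forall t, x * t * y = 0) -> forall t, sigma x * t * sigma y = 0.
Proof.
case: sigma_aut => tau _ sigmaK xTy0 t.
by rewrite -(sigmaK t) -!rmorphM xTy0 rmorph0.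
Qed.

Lemma automorphism_e :
    (exists m : M, m <> 0) ->
    only_trivial_idempotents A -> only_trivial_idempotents B ->
  exists u, sigma e = TrianMx 1 u 0.
Proof.
move=> [n n_neq0] A_idem B_idem.
have feT0 t : f * t * e = 0.
  by case: t => a m b; rewrite ?trianE /= ?bimodE.
have sfe0 := automorphism_mul0 _ _ feT0.
have sI : injective sigma by apply: bij_inj.
have e_neq0 : sigma e <> 0.
  by rewrite -(rmorph0 sigma) => /sI [/eqP]; rewrite oner_eq0.
have f_neq0 : sigma f <> 0.
  rewrite -(rmorph0 sigma) => /sI f0; apply: n_neq0.
  have /(congr1 (@trian_ur _ _ _ _)) : (TrianMx 0 n 0 : T) * f = 0.
    by rewrite f0 mulr0.
  by rewrite ?trianE /= ?bimodE.
have sfsf : sigma f * sigma f = sigma f.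
  by rewrite -rmorphM ?trianE /= ?bimodE.
have : sigma e * sigma e = sigma e by rewrite -rmorphM trian_ee.
move: rmorph_trian_f e_neq0 f_neq0 sfe0 sfsf; case: (sigma e) => [a u b].
rewrite (trianB 1 0 1) sub0r => -> se_neq0 sf_neq0 sfe0 sfsf sese.
have [aa _ bb] : TrianMx a u b * TrianMx a u b = TrianMx a u b :> T by [].
(* Diagonal (0, 0) or (1, 1) would make [sigma e] or [sigma f] a strictly upper triangular
   idempotent, hence zero; (0, 1) contradicts [sfe0]. *)
case: (A_idem a aa) (B_idem b bb) => a_eq [] b_eq; subst a b.
- by case: se_neq0; rewrite (idempotent_ur0 _ sese).
- case: n_neq0; have /(congr1 (@trian_ur _ _ _ _)) := sfe0 (TrianMx 0 n 0).
  by rewrite ?trianE /= ?bimodE.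
- by exists u.
- move: sf_neq0 sfsf; rewrite !subrr => sf_neq0 sfsf.
  by case: sf_neq0; rewrite (idempotent_ur0 _ sfsf).
Qed.

End Automorphism.
End Trian.

Arguments trian_e {R A B M}.
Arguments trian_f {R A B M}.
Local Notation e := trian_e.
Local Notation f := trian_f.

Theorem theorem5p1 (R : comPzRingType) (A B : algType R) (M : bimodType A B)
    (M_neq0 : exists m : M, m <> 0)
    (M_faithful_l : left_faithful M) (M_faithful_r : right_faithful M)
    (sigma : {lrmorphism Trian A M B -> Trian A M B})
    (sigma_aut : is_automorphism sigma)
    (A_idem : only_trivial_idempotents A)
    (B_idem : only_trivial_idempotents B)
    (d : {linear Trian A M B -> Trian A M B})
    (d_der : is_sigma_derivation sigma d)
    (d_centralizing : is_sigma_centralizing sigma d) :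
  forall x : Trian A M B, d x = 0.
Proof.
have [u se] := automorphism_e _ _ _ _ _ sigma_aut M_neq0 A_idem B_idem.
have de0 : d e = 0.
  have := d_centralizing e; have := d_der e e.
  rewrite trian_ee se; case: (d e) => a m b.
  (* The diagonal entries of the derivation rule read [a = a + a] and [b = 0]. *)
  rewrite ?trianE /= ?bimodE => -[a0 _ ->].
  have {a0} -> : a = 0 by apply: (addrI a); rewrite addr0 -a0.
  by rewrite ?trianE /= ?bimodE => /central_ur ->.
have df0 : d f = 0.
  have d1 : d 1 = 0.
    apply: (addrI (d 1)); rewrite addr0 -[in RHS](mulr1 1) d_der.
    by rewrite rmorph1 mulr1 mul1r.
  by rewrite trian_f_sub raddfB /= d1 de0 subr0.
have dM m : d (TrianMx 0 m 0) = 0.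
  set x : Trian A M B := TrianMx 0 m 0.
  have xef : x = e * x * f by rewrite /x ?trianE /= ?bimodE.
  (* This confines [d x] to the upper right corner. *)
  have dx : d x = sigma e * d x * f.
    by rewrite [in LHS]xef !d_der de0 df0 mul0r add0r mulr0 addr0.
  (* Compare the condition at [e + x] with the one at [x]; the terms with [d e] vanish. *)
  have : central (sigma e * d x - d x * e).
    move=> y; have /(_ y) := d_centralizing (e + x).
    have /(_ y) := d_centralizing x.
    rewrite !raddfD /= de0 add0r => cx.
    have -> : (sigma e + sigma x) * d x - d x * (e + x)
        = (sigma x * d x - d x * x) + (sigma e * d x - d x * e).
      by rewrite mulrDl mulrDr opprD addrACA addrC.
    by rewrite mulrDl mulrDr cx => /addrI.
  move: dx; case: (d x) => a n b; rewrite se ?trianE /= ?bimodE.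
  case=> -> n_eq ->; rewrite ?trianE /= ?bimodE => /central_ur n0.
  by rewrite n0.
have dA a : d (TrianMx a 0 0) = 0.
  set x : Trian A M B := TrianMx a 0 0.
  have xe : x = x * e by rewrite /x ?trianE /= ?bimodE.
  have dxe : d x = d x * e by rewrite [in LHS]xe d_der de0 mulr0 addr0.
  have dxM m : d x * TrianMx 0 m 0 = 0.
    have := d_der x (TrianMx 0 m 0).
    by rewrite dM mulr0 addr0 /x ?trianE /= ?bimodE dM.
  move: dxe dxM; case: (d x) => a' m' b'.
  rewrite ?trianE /= ?bimodE => -[-> ->] dxM.
  rewrite (M_faithful_l a') // => m.
  by have := dxM m; rewrite ?trianE /= ?bimodE => -[].
have dB b : d (TrianMx 0 0 b) = 0.
  set x : Trian A M B := TrianMx 0 0 b.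
  have xf : x = f * x * f by rewrite /x ?trianE /= ?bimodE.
  have dxf : d x = sigma f * d x * f.
    by rewrite [in LHS]xf !d_der df0 mul0r add0r mulr0 addr0.
  (* By [dxf], [d x] absorbs [sigma f] on its left, and [sigma e * t * sigma f] is [sigma] of the
     corner element [e * tau t * f], on which [d] vanishes. *)
  have dxM m : sigma e * TrianMx 0 m 0 * d x = 0.
    case: sigma_aut => tau _ sigmaK; set t := TrianMx 0 m 0.
    rewrite dxf !mulrA -(sigmaK t) -!rmorphM.
    have [n ->] : exists n, e * tau t * f = TrianMx 0 n 0.
      case: (tau t) => a' n b'; exists n.
      by rewrite ?trianE /= ?bimodE.
    have := d_der (TrianMx 0 n 0) x.
    have -> : TrianMx 0 n 0 * x = TrianMx 0 (n :* b) 0.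
      by rewrite /x ?trianE /= ?bimodE.
    by rewrite !dM mul0r add0r => <-; rewrite mul0r.
  have sf : sigma f = TrianMx 0 (- u) 1.
    by rewrite rmorph_trian_f se (trianB _ _ _ _ 1 0 1) subrr sub0r subr0.
  move: dxf dxM; rewrite se sf; case: (d x) => a' m' b'.
  (* Here [dxf] expresses [m'] as [(- u) :* b'], so it suffices to kill [b']; [dxM] reduces to
     [m :* b' = 0]. *)
  rewrite ?trianE /= ?bimodE => -[-> -> ] dxM.
  rewrite (M_faithful_r b') ?bimodE // => m.
  by have := dxM m; rewrite ?trianE /= ?bimodE => -[].
case=> a m b.
have -> : TrianMx a m b = TrianMx a 0 0 + TrianMx 0 m 0 + TrianMx 0 0 b.
  by rewrite ?trianE /= ?bimodE.
by rewrite !raddfD /= dA dM dB !addr0.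
Qed.
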